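(* A poset $P$ of dimension two is uniquely realizable if and only if at most one connected component of $\mathrm{Inc}(P)$ is nontrivial and every proper module of the poset induced by $P$ on this component is totally ordered.
   Context: A realizer of a poset $P=(V,\le)$ is a set of linear orders on $V$ whose intersection is $\le$; the dimension is the least cardinality of a realizer; $P$ is uniquely realizable if it has exactly one realizer of cardinality at most two. $\mathrm{Inc}(P)$ is the incomparability graph; a connected component is nontrivial if it has at least two vertices. A module of a poset on $W$ is a set $A\subseteq W$ such that each $v\in W\setminus A$ is below all, above all, or incomparable to all elements of $A$; it is proper if distinct from $W$. *)

(* Defs.v *)
From mathcomp Require Import all_boot all_order.
From mathcomp Require Import boolp classical_sets functions cardinality.

Set Implicit Arguments.
Unset Strict Implicit.
Unset Printing Implicit Defensive.

Import Order.TTheory.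
Local Open Scope classical_set_scope.
Local Open Scope card_scope.
Local Open Scope order_scope.

Definition linear_order (V : Type) (L : rel V) : Prop :=
  [/\ reflexive L, antisymmetric L, transitive L & total L].

(* Relations, and sets of relations, are identified extensionally, so that
   cardinalities of realizers count linear orders. The empty intersection is
   the full relation on V. *)
Definition realizer (d : Order.disp_t) (V : porderType d)
    (R : set (rel V)) : Prop :=
  (forall L, R L -> linear_order L) /\
  (forall x y : V, x <= y <-> forall L, R L -> L x y).

Definition has_dimension (d : Order.disp_t) (V : porderType d)
    (k : nat) : Prop :=
  (exists2 R : set (rel V), realizer R & R #= `I_k) /\
  (forall R : set (rel V), realizer R -> `I_k #<= R).

Definition uniquely_realizable (d : Order.disp_t) (V : porderType d) : Prop :=
  exists! R : set (rel V), realizer R /\ R #<= `I_2.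

Definition inc (d : Order.disp_t) (V : porderType d) : rel V :=
  fun x y => x >< y.

Definition inc_component_of (d : Order.disp_t) (V : porderType d) (x : V) :
    set V :=
  [set y | exists2 p : seq V, path (@inc d V) x p & last x p = y].

Definition inc_component (d : Order.disp_t) (V : porderType d)
    (C : set V) : Prop :=
  exists x : V, C = inc_component_of x.

Definition nontrivial (V : Type) (C : set V) : Prop :=
  exists x y : V, [/\ C x, C y & x <> y].

(* Modules of the poset induced on W, seen as subsets of the ambient poset. *)
Definition is_module (d : Order.disp_t) (V : porderType d)
    (W A : set V) : Prop :=
  A `<=` W /\
  forall v, W v -> ~ A v ->
    [\/ forall a, A a -> v < a,
        forall a, A a -> a < v
      | forall a, A a -> v >< a].

Definition proper_module (d : Order.disp_t) (V : porderType d)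
    (W A : set V) : Prop :=
  is_module W A /\ A <> W.

Definition totally_ordered (d : Order.disp_t) (V : porderType d)
    (A : set V) : Prop :=
  forall x y : V, A x -> A y -> x >=< y.

(* Main.v *)
Require Import Defs.
From mathcomp Require Import all_boot all_order.
From mathcomp Require Import boolp classical_sets functions cardinality.

Set Implicit Arguments.
Unset Strict Implicit.
Unset Printing Implicit Defensive.

Import Order.TTheory.
Local Open Scope classical_set_scope.
Local Open Scope card_scope.
Local Open Scope order_scope.

(** The realizers {L1, L2} of P correspond to the transitive orientations Q of
    Inc(P), up to reversal, through L1 = (<=) U Q and L2 = (<=) U Q^op.

    A module A of Inc(P) can be reoriented on its own: let every vertex outside
    A see all of A as it sees one fixed vertex of A, and put either Q or Q^op
    inside A. If some edge lies inside A and some edge does not, this gives two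
    essentially different orientations. Components, and modules of the poset on
    a component, are such sets A.

    Conversely, say that two edges uv and uw force each other when vw is not an
    edge. The vertices met by a forcing class form a module which is not a
    chain, so under the hypotheses every class meets every vertex of the
    nontrivial component. Compare two orientations and colour each edge
    according to whether they agree on it; the colour is constant on forcing
    classes. If both colours occur, then some vertex has edges of both colours,
    which yields a triangle with exactly two edges of one colour; the forcing
    class of its third edge then avoids the opposite vertex, a contradiction. *)

(** * Transitive orientations of a graph and reorientation inside a module *)

Section Graphs.
Variables (T : Type) (E : rel T).

Definition edge_module (A : set T) : Prop :=
  forall v a b, ~ A v -> A a -> A b -> E v a = E v b.

Definition transitive_orientation (Q : rel T) : Prop :=
  [/\ forall x y, E x y = Q x y || Q y x,
      forall x y, Q x y -> ~~ Q y x & transitive Q].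

Lemma transitive_orientation_converse (Q : rel T) :
  transitive_orientation Q -> transitive_orientation (fun x y => Q y x).
Proof.
move=> [EQ asQ trQ]; split=> [x y|x y|y x z]; first by rewrite EQ orbC.
- exact: asQ.
- by move=> Qyx Qzy; exact: trQ Qzy Qyx.
Qed.

Definition substitute (A : set T) (a0 : T) (QA Q : rel T) : rel T := fun x y =>
  if `[<A x>] && `[<A y>] then QA x y
  else Q (if `[<A x>] then a0 else x) (if `[<A y>] then a0 else y).

Lemma transitive_orientation_substitute (A : set T) (a0 : T) (QA Q : rel T) :
  symmetric E -> edge_module A -> A a0 ->
  transitive_orientation QA -> transitive_orientation Q ->
  transitive_orientation (substitute A a0 QA Q).
Proof.
move=> symE modA Aa0 [EQA asQA trQA] [EQ asQ trQ].
have irrQ x : Q x x = false by apply/negP => /[dup] /asQ /negP.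
rewrite /substitute; split=> [x y|x y|y x z].
- case: (asboolP (A x)) => Ax; case: (asboolP (A y)) => Ay //=.
  + by rewrite symE (modA _ _ a0) // EQ orbC.
  + by rewrite (modA _ _ a0) // EQ.
- by case: (asboolP (A x)) => Ax; case: (asboolP (A y)) => Ay //=;
    [exact: asQA | exact: asQ ..].
- case: (asboolP (A x)) => Ax; case: (asboolP (A y)) => Ay;
    case: (asboolP (A z)) => Az //=; try exact: trQA; try exact: trQ.
  (* Left over are [x], [z] in [A] and [y] outside: the path would read [Q a0 y] and [Q y a0]. *)
  by move=> Q1 Q2; have := asQ _ _ Q1; rewrite Q2.
Qed.

(** * Forcing classes of edges and the vertices they meet *)

(* In every transitive orientation, two edges at a vertex whose other ends are
   not adjacent point both away from it or both towards it. *)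
Inductive forced (x y : T) : T -> T -> Prop :=
| forced_refl : forced x y x y
| forced_sym u v : forced x y u v -> forced x y v u
| forced_step u v w :
    forced x y u v -> E u w -> ~~ E v w -> forced x y u w.

Definition forced_span (x y : T) : set T := [set u | exists v, forced x y u v].

Lemma forced_edge (x y u v : T) :
  symmetric E -> E x y -> forced x y u v -> E u v.
Proof. by move=> symE Exy; elim=> // {}u {}v _; rewrite symE. Qed.

(** The edges of a forcing class form a connected graph, so a property that passes along them
    spreads from [x] to every vertex met. *)
Lemma forced_span_ind (x y : T) (P : T -> Prop) :
  P x -> (forall u v, forced x y u v -> P u -> P v) ->
  forall u, forced_span x y u -> P u.
Proof.
move=> Px stepP u [v Fuv].
suff [] : P u /\ P v by [].
elim: Fuv => [|{}u {}v _ []//|{}u {}v w Fuv [Pu _] Euw nEvw].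
- by split=> //; exact: stepP (forced_refl x y) Px.
- by split=> //; apply: stepP Pu; exact: forced_step nEvw.
Qed.

(** If [v] saw one end of an edge of the class and not the other, that edge would force an edge
    ending in [v]. *)
Lemma forced_span_module (x y v u : T) :
  symmetric E -> ~ forced_span x y v -> forced_span x y u -> E v u = E v x.
Proof.
move=> symE nv; move: u; apply: forced_span_ind => // u w Fuw <-.
apply/idP/idP => Ev; apply/negPn/negP => nE; apply: nv.
- exists w; apply/forced_sym; apply: forced_step (forced_sym Fuw) _ _;
    by rewrite symE.
- exists u; apply/forced_sym; apply: forced_step Fuw _ _; by rewrite symE.
Qed.

(** * Symmetric edge colourings constant under forcing *)

Section Colourings.
Variable c : rel T.
Hypothesis (irrE : irreflexive E) (symE : symmetric E) (symc : symmetric c).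
Hypothesis cE : forall u v w, E u v -> E u w -> ~~ E v w -> c u v = c u w.

(** Invariant along the class of [x z]: each edge keeps the colour of [x z], and both its ends are
    joined to [y] by edges of the colour of [y x]. A forced edge ending in [y] would then be a
    loop. *)
Lemma triangle_not_spanned (x y z : T) :
  E x z -> E y x -> E y z -> c y x = c y z -> c x z != c y x ->
  ~ forced_span x z y.
Proof.
move=> Exz Eyx Eyz cyz cxz [v Fyv].
suff /(_ _ _ Fyv)[_ Eyy _ _ _] : forall u w, forced x z u w ->
    [/\ c u w = c x z, E y u, c y u = c y x, E y w & c y w = c y x].
  by rewrite irrE in Eyy.
move=> {v Fyv} u w; elim=> [//|{}u {}w _ []|{}u {}w t Fuw]; first by rewrite symc.
move=> [cuw Eyu cyu Eyw cyw] Eut nEwt.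
have Euw := forced_edge symE Exz Fuw.
have cut : c u t = c x z by rewrite -cuw; apply/esym/cE.
have Eyt : E y t.
  apply/negPn/negP => nEyt; move/eqP: cxz; apply.
  by rewrite -cut -cyu [RHS]symc; apply: cE; rewrite // symE.
by split=> //; rewrite -cyw; apply/esym/cE.
Qed.

Lemma colouring_constant (x y u v : T) :
  (forall x y u v, E x y -> E u v -> forced_span x y u) ->
  E x y -> E u v -> c x y = c u v.
Proof.
move=> span; suff H x' y' u' v' : E x' y' -> E u' v' -> c x' y' -> c u' v'.
  by move=> Exy Euv; apply/idP/idP; exact: H.
move=> {x y u v} Exy Euv cxy; apply/negPn/negP => ncuv.
(* The class of [u' v'] reaches [x'], so [x'] also has an edge of the second colour. *)
have [z Fxz] := span _ _ _ _ Euv Exy.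
have Exz := forced_edge symE Euv Fxz.
have ncxz : c x' z = false.
  apply/negbTE; elim: Fxz => [//|? ? _|a b t Fab IH Eat nEbt].
    by rewrite symc.
  by rewrite -(cE (forced_edge symE Euv Fab) Eat nEbt).
have Eyz : E y' z.
  by apply/negPn/negP => /(cE Exy Exz); rewrite cxy ncxz.
(* Either colour of [y' z] makes two sides of the triangle agree: the odd side is [x' z] in the
   first case, [x' y'] in the second. *)
case cyz: (c y' z).
- apply: (@triangle_not_spanned x' y' z) => //; rewrite 1?symE //.
  + by rewrite symc cxy cyz.
  + by rewrite ncxz symc cxy.
  + by apply: span Exz _; exact: Eyz.
- apply: (@triangle_not_spanned x' z y') => //; rewrite 1?symE //.
  + by rewrite symc ncxz symc cyz.
  + by rewrite cxy symc ncxz.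
  + by apply: (span _ _ _ x') => //; rewrite symE.
Qed.

End Colourings.

Lemma transitive_orientation_unique (Q Q' : rel T) :
  (forall x y u v, E x y -> E u v -> forced_span x y u) ->
  transitive_orientation Q -> transitive_orientation Q' ->
  Q' = Q \/ Q' = (fun x y => Q y x).
Proof.
move=> span [EQ asQ trQ] [EQ' asQ' trQ'].
have irrE : irreflexive E.
  by move=> x; rewrite EQ orbb; apply/negP => /[dup] /asQ /negP.
have symE : symmetric E by move=> x y; rewrite !EQ orbC.
have convE (P : rel T) : transitive_orientation P ->
    forall x y, E x y -> P y x = ~~ P x y.
  move=> [EP asP _] x y; rewrite EP => /orP[] Pxy.
    by rewrite Pxy; apply/negbTE/asP.
  by rewrite Pxy (asP _ _ Pxy).
(* If one edge entered [u] and the other left it, transitivity would join [v] and [w]. *)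
have forceE (P : rel T) : transitive_orientation P ->
    forall u v w, E u v -> E u w -> ~~ E v w -> P u v = P u w.
  move=> tP u v w Euv Euw nEvw; case: (tP) => EP asP trP.
  have := convE _ tP _ _ Euv; have := convE _ tP _ _ Euw.
  move: nEvw; rewrite EP negb_or => /andP[nvw nwv].
  case Puv: (P u v); case Puw: (P u w) => //= Pwu Pvu.
    by rewrite (trP _ _ _ Pwu Puv) in nwv.
  by rewrite (trP _ _ _ Pvu Puw) in nvw.
have tQ : transitive_orientation Q by split.
have tQ' : transitive_orientation Q' by split.
pose c : rel T := fun x y => E x y && (Q x y == Q' x y).
have symc : symmetric c.
  move=> x y; rewrite /c symE; case Eyx: (E y x) => //=.
  by rewrite (convE _ tQ _ _ Eyx) (convE _ tQ' _ _ Eyx) (inj_eq negb_inj).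
have cE u v w : E u v -> E u w -> ~~ E v w -> c u v = c u w.
  move=> Euv Euw nEvw; rewrite /c Euv Euw /=.
  by rewrite (forceE _ tQ u v w) // (forceE _ tQ' u v w).
have notE (P : rel T) x y : transitive_orientation P -> ~~ E x y ->
    P x y = false.
  by move=> [EP _ _]; rewrite EP negb_or => /andP[/negbTE].
have [[x0 [y0 [E0 c0]]]|noc] := pselect (exists x y, E x y /\ c x y).
- left; apply/funext => x; apply/funext => y.
  have [Exy|nExy] := boolP (E x y); last by rewrite (notE Q) ?(notE Q').
  have := colouring_constant irrE symE symc cE span Exy E0.
  by rewrite c0 => /andP[_ /eqP].
- right; apply/funext => x; apply/funext => y.
  have [Exy|nExy] := boolP (E x y); last by rewrite (notE Q') ?(notE Q) // symE.
  rewrite (convE _ tQ _ _ Exy).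
  have : ~~ c x y by apply/negP => cxy; apply: noc; exists x, y.
  by rewrite /c Exy /=; case: (Q x y); case: (Q' x y).
Qed.

End Graphs.

(** * Realizers as pairs of opposite transitive orientations *)

Section Posets.
Context {d : Order.disp_t} {V : porderType d}.
Implicit Types (Q L : rel V) (R : set (rel V)).

Lemma inc_sym : symmetric (@inc d V).
Proof. by move=> x y; rewrite /inc comparable_sym. Qed.

Lemma inc_irr : irreflexive (@inc d V).
Proof. by move=> x; rewrite /inc comparablexx. Qed.

Definition order_extension Q : rel V := fun x y => (x <= y) || Q x y.

Definition orientation_realizer Q : set (rel V) :=
  [set order_extension Q; order_extension (fun x y => Q y x)].

Lemma linear_order_extension Q :
  transitive_orientation (@inc d V) Q -> linear_order (order_extension Q).
Proof.
move=> [EQ asQ trQ].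
have compQ x y : Q x y -> (x <= y) || (y <= x) = false.
  move=> Qxy; apply/negbTE; rewrite -[_ || _]/(x >=< y) -[~~ _]/(inc x y).
  by rewrite EQ Qxy.
have totQ x y : [|| x <= y, y <= x, Q x y | Q y x].
  by rewrite orbA -EQ orbN.
rewrite /order_extension; split.
- by move=> x; rewrite lexx.
- move=> x y /andP[/orP[xy|Qxy] /orP[yx|Qyx]].
  + by apply/le_anti/andP.
  + by have := compQ _ _ Qyx; rewrite xy orbT.
  + by have := compQ _ _ Qxy; rewrite yx orbT.
  + by have := asQ _ _ Qxy; rewrite Qyx.
- move=> y x z /orP[xy|Qxy] /orP[yz|Qyz].
  + by rewrite (le_trans xy yz).
  (* In the mixed cases, [z] below [x] or [Q z x] would combine with one of the two hypotheses to
     make a [Q]-pair comparable. *)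
  + have /or4P[->//|zx|->|Qzx] := totQ x z; rewrite ?orbT //.
      by have := compQ _ _ Qyz; rewrite (le_trans zx xy) orbT.
    by have := compQ _ _ (trQ _ _ _ Qyz Qzx); rewrite xy orbT.
  + have /or4P[->//|zx|->|Qzx] := totQ x z; rewrite ?orbT //.
      by have := compQ _ _ Qxy; rewrite (le_trans yz zx) orbT.
    by have := compQ _ _ (trQ _ _ _ Qzx Qxy); rewrite yz orbT.
  + by rewrite (trQ _ _ _ Qxy Qyz) orbT.
- move=> x y; have /or4P[->|->|->|->] := totQ x y; by rewrite ?orbT.
Qed.

Lemma orientation_realizer_realizer Q :
  transitive_orientation (@inc d V) Q -> realizer (orientation_realizer Q).
Proof.
move=> tQ; split=> [L [] ->|x y]; first exact: linear_order_extension.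
  exact/linear_order_extension/transitive_orientation_converse.
split=> [xy L [] ->|H]; rewrite /order_extension ?xy //.
have /orP[//|Qxy] := H _ (or_introl erefl).
have /orP[//|Qyx] := H _ (or_intror erefl).
by case: tQ => _ asQ _; have := asQ _ _ Qxy; rewrite Qyx.
Qed.

Lemma card_orientation_realizer Q : orientation_realizer Q #<= `I_2.
Proof.
apply: card_le_trans (card_image_le (fun i => if i == 0%N then
  order_extension Q else order_extension (fun x y => Q y x)) `I_2).
by apply: subset_card_le => L [] ->; [exists 0%N | exists 1%N].
Qed.

(** The orientation is recovered by restricting the extension to incomparable pairs. *)
Lemma order_extension_inj Q Q' :
  transitive_orientation (@inc d V) Q -> transitive_orientation (@inc d V) Q' ->
  order_extension Q = order_extension Q' -> Q = Q'.
Proof.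
have QE P : transitive_orientation (@inc d V) P ->
    P = fun x y => inc x y && order_extension P x y.
  move=> [EP _ _]; apply/funext => x; apply/funext => y.
  rewrite /order_extension; have [Exy|nExy] /= := boolP (inc x y).
    by move: Exy; rewrite /inc negb_or => /andP[/negbTE ->].
  by move: nExy; rewrite EP negb_or => /andP[/negbTE ->].
by move=> tQ tQ' eQ; rewrite (QE _ tQ) (QE _ tQ') eQ.
Qed.

Lemma orientation_realizer_inj Q Q' :
  transitive_orientation (@inc d V) Q -> transitive_orientation (@inc d V) Q' ->
  orientation_realizer Q = orientation_realizer Q' ->
  Q = Q' \/ Q = (fun x y => Q' y x).
Proof.
move=> tQ tQ' eR; have : orientation_realizer Q (order_extension Q) by left.
rewrite eR => -[] /order_extension_inj; first by left; auto.
by right; auto using transitive_orientation_converse.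
Qed.

(** [L1] and [L2] may coincide, which covers singletons. *)
Lemma realizer_two_orders R :
  R !=set0 -> R #<= `I_2 -> exists L1 L2, R = [set L1; L2].
Proof.
move=> /set0P/eqP R0 /pfcard_geP[//|[f]].
exists (f 0%N), (f 1%N); apply/seteqP; split=> L.
  move=> /(@surj _ _ _ _ f)[[|[|//]] _ <-]; [by left | by right].
by move=> [] ->; apply: funS.
Qed.

Lemma realizer_orientation R :
  realizer R -> R !=set0 -> R #<= `I_2 ->
  exists2 Q, transitive_orientation (@inc d V) Q & R = orientation_realizer Q.
Proof.
move=> [linR capR] R0 /(realizer_two_orders R0)[L1 [L2 eR]].
have [refl1 anti1 tr1 tot1] : linear_order L1 by apply: linR; rewrite eR; left.
have [refl2 anti2 tr2 tot2] : linear_order L2 by apply: linR; rewrite eR; right.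
have leE x y : (x <= y) = L1 x y && L2 x y.
  apply/idP/andP => [/capR H|[H1 H2]].
    by split; apply: H; rewrite eR; [left|right].
  by apply/capR => L; rewrite eR => -[] ->.
have a1 x y : L1 x y -> L1 y x -> x = y by move=> *; apply/anti1/andP.
have a2 x y : L2 x y -> L2 y x -> x = y by move=> *; apply/anti2/andP.
(* The two orders disagree exactly on the incomparable pairs; [Q] directs these as [L1] does. *)
pose Q : rel V := fun x y => [&& x != y, L1 x y & L2 y x].
exists Q.
  split=> [x y|x y|y x z].
  - rewrite /inc /Order.comparable !leE /Q eq_sym.
    have [->|nxy] /= := eqVneq y x; first by rewrite refl1 refl2.
    move: (tot1 x y) (tot2 x y) (a1 x y) (a2 x y).
    case: (L1 x y); case: (L1 y x); case: (L2 x y); case: (L2 y x) => //=;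
      by move=> _ _ e1 e2; case/eqP: nxy;
        first [exact: esym (e1 isT isT) | exact: esym (e2 isT isT)].
  - move=> /and3P[nxy l1 l2]; apply/negP => /and3P[_ l1' _].
    by rewrite (a1 _ _ l1 l1') eqxx in nxy.
  - move=> /and3P[nxy l1 l2] /and3P[nyz l1' l2']; apply/and3P; split.
    + by apply: contra nxy => /eqP xz; apply/eqP/a1; rewrite // xz.
    + exact: tr1 l1'.
    + exact: tr2 l2.
have extE L L' : reflexive L -> total L' ->
    (forall x y, L' x y -> L' y x -> x = y) ->
    (forall x y, (x <= y) = L x y && L' x y) ->
    L = order_extension (fun x y => [&& x != y, L x y & L' y x]).
  move=> rL tL aL lE; apply/funext => x; apply/funext => y.
  rewrite /order_extension lE; have [->|] /= := eqVneq x y.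
    by rewrite rL orbF; have := tL y y; rewrite orbb.
  by move=> _; have := tL x y; case: (L x y) => //= /orP[] ->; rewrite ?orbT.
rewrite eR /orientation_realizer; congr [set _; _].
  exact: extE.
rewrite (extE L2 L1) //; last by move=> x y; rewrite leE andbC.
congr order_extension; apply/funext => x; apply/funext => y.
by rewrite /Q eq_sym [L2 _ _ && _]andbC.
Qed.

(** The empty set realizes the full relation; the lower bound in the dimension excludes it. *)
Lemma realizer_nonempty R : has_dimension V 2 -> realizer R -> R !=set0.
Proof.
move=> [_ minR] /minR R2; apply/set0P/eqP => R0.
by move: R2; rewrite R0 card_le0 => /eqP /IIn_eq0.
Qed.

Lemma edge_module_not_uniquely_realizable (A : set V) x y u w :
  has_dimension V 2 -> edge_module (@inc d V) A ->
  A x -> A y -> inc x y -> ~ (A u /\ A w) -> inc u w ->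
  ~ uniquely_realizable V.
Proof.
move=> dim2 modA Ax Ay Exy nAuw Euw [R [[rR R2] uniqR]].
have [Q tQ _] := realizer_orientation rR (realizer_nonempty dim2 rR) R2.
have tQc := transitive_orientation_converse tQ.
(* [Q1] may differ from [Q], which can direct an outer vertex towards part of [A] and away from the
   rest. [Q1] and [Q2] differ only inside [A]: the edge [x y] shows that they are distinct, and
   [u w] that they are not opposite. *)
pose Q1 := substitute A x Q Q; pose Q2 := substitute A x (fun x y => Q y x) Q.
have t1 : transitive_orientation (@inc d V) Q1.
  by apply: transitive_orientation_substitute => //; exact: inc_sym.
have t2 : transitive_orientation (@inc d V) Q2.
  by apply: transitive_orientation_substitute => //; exact: inc_sym.
have u1 := uniqR _ (conj (orientation_realizer_realizer t1)
  (card_orientation_realizer Q1)).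
have u2 := uniqR _ (conj (orientation_realizer_realizer t2)
  (card_orientation_realizer Q2)).
have [e|e] := orientation_realizer_inj t1 t2 (etrans (esym u1) u2).
- have := congr1 (fun q : rel V => q x y) e; rewrite /Q1 /Q2 /substitute.
  rewrite !asboolT //=; case: tQ => EQ asQ _.
  move: Exy; rewrite EQ => /orP[] Qxy; rewrite Qxy.
    by move=> /esym; apply/negP/asQ.
  by apply/negP/asQ.
- have := congr1 (fun q : rel V => q u w) e.
  have -> : Q1 u w = Q2 u w.
    rewrite /Q1 /Q2 /substitute; case: asboolP => //= Au; case: asboolP => //= Aw.
    by case: nAuw.
  case: t2 => E2 as2 _; move: Euw; rewrite E2 => /orP[] Q2uw; rewrite Q2uw.
    by move=> /esym; apply/negP/as2.
  by apply/negP/as2.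
Qed.

(** * Components of the incomparability graph and their modules *)

Lemma inc_component_of_refl (x : V) : inc_component_of x x.
Proof. by exists [::]. Qed.

Lemma inc_component_of_ind (x : V) (P : V -> Prop) :
  P x -> (forall u v, inc u v -> P u -> P v) ->
  forall y, inc_component_of x y -> P y.
Proof.
move=> Px stepP y [p]; elim: p x Px => [|z p IH] x Px /=; first by move=> _ <-.
by move=> /andP[Exz pth] e; apply: (IH z) => //; exact: stepP Exz Px.
Qed.

Lemma inc_component_of_edge (x u v : V) :
  inc u v -> inc_component_of x u -> inc_component_of x v.
Proof.
move=> Euv [p pth lst]; exists (rcons p v); last by rewrite last_rcons.
by rewrite rcons_path pth lst.
Qed.

Lemma inc_component_of_eq (x y : V) :
  inc_component_of x y -> inc_component_of x = inc_component_of y.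
Proof.
move: y; apply: inc_component_of_ind => // u v Euv ->; apply/seteqP; split.
  apply: inc_component_of_ind; last by move=> ? ?; exact: inc_component_of_edge.
  by apply: inc_component_of_edge (inc_component_of_refl v); rewrite inc_sym.
apply: inc_component_of_ind; last by move=> ? ?; exact: inc_component_of_edge.
exact: inc_component_of_edge Euv (inc_component_of_refl u).
Qed.

Lemma nontrivial_inc_component (C : set V) :
  inc_component C -> nontrivial C ->
  exists x y, C = inc_component_of x /\ inc x y.
Proof.
move=> [x ->] [u [v [Cu Cv uv]]].
have [[y Exy]|nE] := pselect (exists y, inc x y); first by exists x, y.
have only w : inc_component_of x w -> w = x.
  move: w; apply: inc_component_of_ind => // a b Eab ax.
  by case: nE; exists b; rewrite -ax.
by case: uv; rewrite (only _ Cu) (only _ Cv).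
Qed.

Lemma nontrivial_inc_component_of (x y : V) :
  inc x y -> nontrivial (inc_component_of x).
Proof.
move=> Exy; exists x, y; split; first exact: inc_component_of_refl.
  exact: inc_component_of_edge Exy (inc_component_of_refl x).
by move=> xy; rewrite xy inc_irr in Exy.
Qed.

Lemma edge_module_inc_component (x : V) :
  edge_module (@inc d V) (inc_component_of x).
Proof.
have no v a : ~ inc_component_of x v -> inc_component_of x a -> inc v a = false.
  move=> nv Ca; apply/negbTE/negP => Eva; apply: nv.
  by apply: inc_component_of_edge Ca; rewrite inc_sym.
by move=> v a b nv Ca Cb; rewrite (no _ _ nv Ca) (no _ _ nv Cb).
Qed.

Lemma edge_module_is_module (x : V) (A : set V) :
  is_module (inc_component_of x) A -> edge_module (@inc d V) A.
Proof.
move=> [AC modA] v a b nAv Aa Ab.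
have [Cv|nCv] := pselect (inc_component_of x v); last first.
  by apply: (edge_module_inc_component (x := x)) => //; exact: AC.
have [H|H|H] := modA _ Cv nAv.
- by rewrite /inc /Order.comparable (ltW (H _ Aa)) (ltW (H _ Ab)).
- by rewrite /inc /Order.comparable (ltW (H _ Aa)) (ltW (H _ Ab)) !orbT.
- by rewrite /inc (H _ Aa) (H _ Ab).
Qed.

(** A vertex outside that is comparable to the span cannot change from below to above along an edge
    of the class: lying between its two ends, it would make them comparable. *)
Lemma forced_span_is_module (x y : V) :
  inc x y -> is_module (inc_component_of x) (forced_span (@inc d V) x y).
Proof.
move=> Exy; have symE := inc_sym; split.
  apply: forced_span_ind; first exact: inc_component_of_refl.
  move=> u v /(forced_edge symE Exy); exact: inc_component_of_edge.
move=> v _ nv; have Ev := forced_span_module symE nv.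
have [Evx|nEvx] := boolP (inc v x).
  by apply: Or33 => a /Ev Eva; rewrite -[_ >< _]/(inc v a) Eva.
have cmp u : forced_span (@inc d V) x y u -> (v < u) || (u < v).
  move=> Fu; move: nEvx; rewrite -(Ev _ Fu) negbK => /orP[] vu; rewrite !lt_neqAle.
  - by rewrite vu andbT; apply/orP; left; apply/eqP => e; apply: nv; rewrite e.
  - by rewrite vu andbT; apply/orP; right; apply/eqP => e; apply: nv; rewrite -e.
have spanF u w : forced (@inc d V) x y u w -> forced_span (@inc d V) x y w.
  by move=> F; exists u; apply: forced_sym.
have Fx : forced_span (@inc d V) x y x by exists y; exact: forced_refl.
have /orP[vx|xv'] := cmp _ Fx.
- apply: Or31; apply: forced_span_ind => // u w Fuw vu.
  have /orP[//|wv] := cmp _ (spanF _ _ Fuw).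
  have := forced_edge symE Exy Fuw.
  by rewrite /inc /Order.comparable (ltW (lt_trans wv vu)) orbT.
- apply: Or32; apply: forced_span_ind => // u w Fuw uv.
  have /orP[vw|//] := cmp _ (spanF _ _ Fuw).
  have := forced_edge symE Exy Fuw.
  by rewrite /inc /Order.comparable (ltW (lt_trans uv vw)).
Qed.

End Posets.

Theorem mainTheorem11 (d : Order.disp_t) (V : porderType d)
    (dim2 : has_dimension V 2) :
  uniquely_realizable V <->
  (forall C C' : set V,
     inc_component C -> nontrivial C ->
     inc_component C' -> nontrivial C' -> C = C') /\
  (forall C : set V, inc_component C -> nontrivial C ->
   forall A : set V, proper_module C A -> totally_ordered A).
Proof.
split=> [uniqV|[oneC modC]].
  split=> [C C' iC nC iC' nC'|C iC nC A [modA neA] x y Ax Ay].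
    have [x [y [eC Exy]]] := nontrivial_inc_component iC nC.
    have [u [w [eC' Euw]]] := nontrivial_inc_component iC' nC'.
    apply: contrapT => CC'.
    apply: (edge_module_not_uniquely_realizable dim2 _ _ _ Exy _ Euw uniqV).
    - exact: (edge_module_inc_component (x := x)).
    - exact: inc_component_of_refl.
    - exact: inc_component_of_edge Exy (inc_component_of_refl x).
    - move=> [/inc_component_of_eq xu _]; by apply: CC'; rewrite eC eC'.
  apply/negPn/negP => Exy; case: iC => x0 eC; move: modA neA; rewrite eC.
  move=> modA neA; apply: neA; apply/seteqP; split; first by case: modA.
  (* No edge leaves [A], so the component of [x] is contained in [A]. *)
  have inA u w : inc u w -> A u /\ A w.
    move=> Euw; apply: contrapT => nA.
    apply: (edge_module_not_uniquely_realizable dim2 _ Ax Ay Exy nA Euw uniqV).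
    exact: edge_module_is_module modA.
  rewrite (inc_component_of_eq (y := x)); last by case: modA => sA _; exact: sA.
  by apply: inc_component_of_ind => // u v /inA[].
have span (x y u w : V) : inc x y -> inc u w -> forced_span (@inc d V) x y u.
  move=> Exy Euw.
  have Cu : inc_component_of x u.
    have -> : inc_component_of x = inc_component_of u.
      by apply: oneC; [exists x | exact: nontrivial_inc_component_of Exy
                      | exists u | exact: nontrivial_inc_component_of Euw].
    exact: inc_component_of_refl.
  (* A smaller span would be a proper module containing the incomparable [x] and [y]. *)
  have [->//|ne] := pselect (forced_span (@inc d V) x y = inc_component_of x).
  case/negP: (Exy).
  apply: (modC _ (ex_intro _ x erefl) (nontrivial_inc_component_of Exy) _
    (conj (forced_span_is_module Exy) ne)).
    by exists y; exact: forced_refl.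
  by exists x; apply/forced_sym/forced_refl.
have [[R rR cardR] _] := dim2.
have {}cardR : R #<= `I_2 by move: cardR => /card_eqPle[].
exists R; split=> // R' [rR' cardR'].
have [Q tQ ->] := realizer_orientation rR (realizer_nonempty dim2 rR) cardR.
have [Q' tQ' ->] := realizer_orientation rR' (realizer_nonempty dim2 rR') cardR'.
have [->//|->] := transitive_orientation_unique span tQ tQ'.
(* Reversing the orientation only swaps the two linear orders. *)
exact: setUC.
Qed.
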